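(* Let $\Pi$ be a (finite, nonempty) set of patterns and $k=\max_{\pi\in\Pi}|\pi|$. There is an algorithm which, given $\Pi$ and $n$, constructs the set $S_{\le n}(\Pi)$ in time $O(|S_{\le n-1}(\Pi)|\cdot n^2 k)$.
   Context: A permutation in $S_n$ is a word containing each of $1,\dots,n$ exactly once; $S_{\le n}=S_1\cup\dots\cup S_n$. For $\pi\in S_k$ and $\tau\in S_n$, a $\pi$-hit in $\tau$ is a $k$-letter subsequence of $\tau$ order-isomorphic to $\pi$ (i.e. with the same relative order of letters); $\tau$ avoids $\Pi$ if it has no $\pi$-hit for any $\pi\in\Pi$. For a set $D$ of permutations, $D(\Pi)$ denotes the elements of $D$ avoiding $\Pi$; in particular $S_{\le n}(\Pi)$ and $S_n(\Pi)$. Model of computation: a unit-cost RAM in which hash tables storing permutations support insertion and membership queries in constant time per operation (beyond the time to read the key), and the elementary operations of inserting or deleting a letter of a permutation of length at most $n$ and re-standardizing take $O(n)$ time.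
   Formalization: O(f) is read as at most C·max(1, f), since f = |S_{≤n-1}(Π)|n²k is 0 when n = 1 or Π contains the pattern 1; ''given Π'' means Π is already in a hash table and k is supplied, since reading Π from a list can exceed the bound. *)

(* Defs.v *)
From HB Require Import structures.
From mathcomp Require Import all_boot finmap.

Set Implicit Arguments.
Unset Strict Implicit.
Unset Printing Implicit Defensive.

Local Open Scope fset_scope.

(** * Permutations as words, and pattern avoidance *)

Definition word := seq nat.

Definition perms_of (n : nat) : seq word := permutations (iota 1 n).

Definition order_iso (u v : word) : bool :=
  (size u == size v) &&
  [forall i : 'I_(size u), forall j : 'I_(size u),
     (nth 0 u i < nth 0 u j) == (nth 0 v i < nth 0 v j)].

(* A subsequence of [tau] is given by its set of positions, i.e. by a mask;
   [order_iso] forces it to have as many letters as [pi]. *)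
Definition has_hit (pi tau : word) : bool :=
  [exists m : (size tau).-tuple bool, order_iso (mask m tau) pi].

Definition avoids (Pi : {fset word}) (tau : word) : bool :=
  [forall pi : Pi, ~~ has_hit (val pi) tau].

(* S_{<= n} = S_1 u ... u S_n: the empty word is not included. *)
Definition perms_le (n : nat) : seq word :=
  flatten [seq perms_of m | m <- iota 1 n].

Definition avoiders_le (Pi : {fset word}) (n : nat) : {fset word} :=
  [fset tau in perms_le n | avoids Pi tau].

Definition is_pattern (pi : word) : Prop :=
  exists2 m, 0 < m & pi \in perms_of m.

Definition max_length (Pi : {fset word}) : nat := \max_(pi <- Pi) size pi.

(** * A unit-cost RAM with hash tables *)

(* [Sub] is truncated; [Lt] and [Eq] evaluate to 0 or 1. There is no
   multiplication, as usual under the uniform cost criterion. *)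
Inductive expr : Type :=
  | Cst of nat
  | Reg of nat
  | Fetch of expr
  | Add of expr & expr
  | Sub of expr & expr
  | Lt of expr & expr
  | Eq of expr & expr.

(* [Insert h a l] inserts into table [h] the word stored in memory at
   addresses a, ..., a + l - 1; [Member x h a l] sets register [x] to 1 or 0
   according to whether that word is in table [h]. Table and register names
   are fixed by the program, so that it uses finitely many of them. *)
Inductive cmd : Type :=
  | Skip
  | Assign of nat & expr
  | Store of expr & expr
  | Insert of nat & expr & expr
  | Member of nat & nat & expr & expr
  | Seq of cmd & cmd
  | If of expr & cmd & cmd
  | While of expr & cmd.

Record state : Type := State {
  reg : nat -> nat;
  mem : nat -> nat;
  tab : nat -> {fset word}
}.

Definition upd (T : Type) (f : nat -> T) (x : nat) (v : T) : nat -> T :=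
  fun y => if y == x then v else f y.

Definition set_reg (s : state) (x v : nat) : state :=
  State (upd (reg s) x v) (mem s) (tab s).

Definition set_mem (s : state) (a v : nat) : state :=
  State (reg s) (upd (mem s) a v) (tab s).

Definition insert_tab (s : state) (h : nat) (w : word) : state :=
  State (reg s) (mem s) (upd (tab s) h (w |` tab s h)).

Definition read_word (s : state) (a l : nat) : word :=
  mkseq (fun i => mem s (a + i)) l.

Fixpoint eval (s : state) (e : expr) : nat :=
  match e with
  | Cst c => c
  | Reg x => reg s x
  | Fetch e1 => mem s (eval s e1)
  | Add e1 e2 => eval s e1 + eval s e2
  | Sub e1 e2 => eval s e1 - eval s e2
  | Lt e1 e2 => eval s e1 < eval s e2
  | Eq e1 e2 => eval s e1 == eval s e2
  end.

(* One unit per operation and per operand. *)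
Fixpoint ecost (e : expr) : nat :=
  match e with
  | Cst _ | Reg _ => 1
  | Fetch e1 => (ecost e1).+1
  | Add e1 e2 | Sub e1 e2 | Lt e1 e2 | Eq e1 e2 => (ecost e1 + ecost e2).+1
  end.

(* [exec c s t s']: started in state [s], [c] halts in state [s'] after time
   [t]. A hash table operation costs one unit plus the length of its key. *)
Inductive exec : cmd -> state -> nat -> state -> Prop :=
  | ExecSkip s : exec Skip s 1 s
  | ExecAssign s x e :
      exec (Assign x e) s (ecost e).+1 (set_reg s x (eval s e))
  | ExecStore s a e :
      exec (Store a e) s (ecost a + ecost e).+1
        (set_mem s (eval s a) (eval s e))
  | ExecInsert s h a l :
      exec (Insert h a l) s (ecost a + ecost l + eval s l).+1
        (insert_tab s h (read_word s (eval s a) (eval s l)))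
  | ExecMember s x h a l :
      exec (Member x h a l) s (ecost a + ecost l + eval s l).+1
        (set_reg s x (read_word s (eval s a) (eval s l) \in tab s h))
  | ExecSeq s1 s2 s3 c1 c2 t1 t2 :
      exec c1 s1 t1 s2 -> exec c2 s2 t2 s3 ->
      exec (Seq c1 c2) s1 (t1 + t2) s3
  | ExecIfTrue s s' e c1 c2 t :
      eval s e != 0 -> exec c1 s t s' ->
      exec (If e c1 c2) s (ecost e + t).+1 s'
  | ExecIfFalse s s' e c1 c2 t :
      eval s e = 0 -> exec c2 s t s' ->
      exec (If e c1 c2) s (ecost e + t).+1 s'
  | ExecWhileTrue s1 s2 s3 e c t1 t2 :
      eval s1 e != 0 -> exec c s1 t1 s2 -> exec (While e c) s2 t2 s3 ->
      exec (While e c) s1 (ecost e + t1 + t2).+1 s3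
  | ExecWhileFalse s e c :
      eval s e = 0 -> exec (While e c) s (ecost e).+1 s.

Lemma exec_det c s t1 s1 t2 s2 :
  exec c s t1 s1 -> exec c s t2 s2 -> t1 = t2 /\ s1 = s2.
Proof.
move=> H; elim: H t2 s2 => {c s t1 s1}; intros;
  match goal with H : exec _ _ ?t ?s |- _ = ?t /\ _ = ?s => inversion H end;
  subst; try by [split | congruence];
  repeat match goal with
  | IH : (forall t s, exec ?c ?r t s -> _), H : exec ?c ?r _ _ |- _ =>
      case: (IH _ _ H) => ? ?; subst; clear IH
  end; try by [split];
  match goal with H : is_true (eval ?s ?e != 0), E : eval ?s ?e = 0 |- _ =>
    by rewrite E in H end.
Qed.

(* The input (Pi, n): Pi is held in hash table 0, n in register 0 and the
   maximal pattern length k in register 1; everything else is blank. *)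
Definition input_state (Pi : {fset word}) (n : nat) : state :=
  State (fun x => if x == 0 then n else if x == 1 then max_length Pi else 0)
        (fun _ => 0)
        (fun h => if h == 0 then Pi else fset0).

(* The set built by a program is the content of hash table 1 when it halts. *)
Definition output (s : state) : {fset word} := tab s 1.

Definition constructs (p : cmd) (Pi : {fset word}) (n : nat)
    (A : {fset word}) (T : nat) : Prop :=
  exists (t : nat) (s : state),
    [/\ exec p (input_state Pi n) t s, output s = A & t <= T].

(* Main.v *)
Require Import Defs.
From mathcomp Require Import all_boot finmap zify.

(* The permutations avoiding Pi are generated level by level: a word of length
   l.+1 arises from exactly one word of length l by inserting its largest letter,
   and the latter word avoids Pi if the former does. To test a candidate, observe
   that a hit of a pattern other than the candidate itself uses at most k letters
   and misses some letter, hence misses one of the first k.+1 positions. So the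
   candidate avoids Pi iff it is not in Pi and the words obtained by deleting one
   of its first min(k.+1, l.+1) letters all avoid Pi, which is looked up in the
   hash table that holds the shorter avoiders. Each avoider of length l < n thus
   costs l.+1 candidates, at most k.+1 deletions for each, and O(n) per deletion. *)

Set Implicit Arguments.
Unset Strict Implicit.
Unset Printing Implicit Defensive.

Local Open Scope fset_scope.
Local Open Scope nat_scope.

(** * Hits and one-letter deletions *)

Lemma order_isoP (u v : word) :
  reflect (size u = size v /\ forall i j, i < size u -> j < size u ->
             (nth 0 u i < nth 0 u j) = (nth 0 v i < nth 0 v j))
          (order_iso u v).
Proof.
apply: (iffP andP) => [[/eqP Euv /forallP H]|[Euv H]].
  split=> // i j ltiu ltju.
  by move: (H (Ordinal ltiu)) => /forallP/(_ (Ordinal ltju))/eqP.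
split; first exact/eqP.
by apply/forallP => i; apply/forallP => j; apply/eqP/H.
Qed.

Lemma has_hitP (pi tau : word) :
  reflect (exists2 m : bitseq, size m = size tau & order_iso (mask m tau) pi)
          (has_hit pi tau).
Proof.
apply: (iffP existsP) => [[m Hm]|[m Em Hm]].
  by exists m; rewrite ?size_tuple.
by exists (tcast Em (in_tuple m)); rewrite val_tcast.
Qed.

Lemma avoidsP (Pi : {fset word}) (tau : word) :
  reflect (forall pi : word, pi \in Pi -> ~~ has_hit pi tau) (avoids Pi tau).
Proof.
apply: (iffP forallP) => [H pi Hpi|H [pi Hpi]]; last exact: H.
exact: (H [` Hpi]).
Qed.

Lemma order_iso_refl u : order_iso u u.
Proof. exact/order_isoP. Qed.

Lemma order_iso_map (f : nat -> nat) (u v : word) :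
  {in u &, {mono f : x y / x < y}} -> order_iso (map f u) v = order_iso u v.
Proof.
move=> fmono; apply/order_isoP/order_isoP; rewrite size_map => -[Euv H];
  split=> // i j ltiu ltju; rewrite -H // !(nth_map 0) // fmono ?mem_nth //.
Qed.

Lemma mem_perms_of n (w : word) : (w \in perms_of n) = perm_eq w (iota 1 n).
Proof. by rewrite mem_permutations. Qed.

Lemma perms_of_size n (w : word) : w \in perms_of n -> size w = n.
Proof. by rewrite mem_perms_of => /perm_size ->; rewrite size_iota. Qed.

Lemma perms_of_uniq n (w : word) : w \in perms_of n -> uniq w.
Proof. by rewrite mem_perms_of => /perm_uniq ->; rewrite iota_uniq. Qed.

Lemma perms_of_mem n (w : word) x : w \in perms_of n -> (x \in w) = (0 < x <= n).
Proof.
by rewrite mem_perms_of => /perm_mem ->; rewrite mem_iota add1n ltnS.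
Qed.

Lemma perms_of_intro n (w : word) :
  size w = n -> uniq w -> {in w, forall x, 0 < x <= n} -> w \in perms_of n.
Proof.
move=> Hs Hu Hx; rewrite mem_perms_of; apply: uniq_perm => //.
  exact: iota_uniq.
have sub : {subset w <= iota 1 n}.
  by move=> x /Hx; rewrite mem_iota add1n ltnS.
by case: (uniq_min_size Hu sub _) => [|_ H x]; rewrite ?size_iota ?Hs //; apply/esym.
Qed.

Lemma iota1S n : iota 1 n.+1 = iota 1 n ++ [:: n.+1].
Proof. by rewrite -(addn1 n) iotaD add1n addn1. Qed.

(* A letter of a permutation is recovered as its rank. *)
Lemma perms_of_count_lt n (w : word) x : w \in perms_of n -> x <= n ->
  count (fun y => y < x) w = x.-1.
Proof.
rewrite mem_perms_of => /permP -> lexn.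
elim: n {w} lexn => [|n IH]; first by rewrite leqn0 => /eqP ->.
rewrite iota1S count_cat /= addn0.
rewrite leq_eqVlt => /orP[/eqP ->|]; last by rewrite ltnS => H; rewrite IH //; lia.
rewrite (_ : count _ _ = n); first by lia.
rewrite -[RHS](size_iota 1 n); apply/eqP; rewrite -all_count; apply/allP => y.
by rewrite mem_iota; lia.
Qed.

Lemma order_iso_perms n (u v : word) :
  u \in perms_of n -> v \in perms_of n -> order_iso u v -> u = v.
Proof.
move=> Hu Hv /order_isoP[Euv H].
apply: (@eq_from_nth _ 0) => // i ltiu.
have ltiv : i < size v by rewrite -Euv.
have := mem_nth 0 ltiu; have := mem_nth 0 ltiv.
rewrite (perms_of_mem _ Hu) (perms_of_mem _ Hv) => /andP[v0 vn] /andP[u0 un].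
apply: succn_inj; rewrite -(prednK u0) -(prednK v0); do 2!congr S.
rewrite -(perms_of_count_lt Hu un) -(perms_of_count_lt Hv vn).
rewrite -!sum1_count [LHS](big_nth 0) [RHS](big_nth 0) Euv.
rewrite [LHS]big_mkcond [RHS]big_mkcond /=.
apply: eq_big_nat => j /andP[_ ltj]; rewrite H // Euv //.
Qed.

Definition ins (w : word) (p : nat) : word :=
  take p w ++ (size w).+1 :: drop p w.

Definition lower (v x : nat) : nat := x - (v < x).

Definition del (w : word) (d : nat) : word :=
  map (lower (nth 0 w d)) (take d w ++ drop d.+1 w).

Lemma lower_mono v :
  {in predC1 v &, {mono lower v : x y / x < y}}.
Proof. by move=> x y; rewrite !inE /lower; lia. Qed.

Lemma lower_range n v x :
  0 < x <= n.+1 -> 0 < v <= n.+1 -> x != v -> 0 < lower v x <= n.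
Proof. by rewrite /lower; lia. Qed.

Lemma lower_id v x : x <= v -> lower v x = x.
Proof. by rewrite /lower; lia. Qed.

Lemma take_drop_nth (w : word) d : d < size w ->
  w = take d w ++ nth 0 w d :: drop d.+1 w.
Proof. by move=> ltd; rewrite -drop_nth // cat_take_drop. Qed.

Lemma mem_take_drop (w : word) d : uniq w -> d < size w ->
  nth 0 w d \notin take d w ++ drop d.+1 w.
Proof.
move=> + ltd; rewrite {1}(take_drop_nth ltd).
by rewrite uniq_catC /= mem_cat => /andP[]; rewrite mem_cat orbC.
Qed.

Lemma lower_mono_del (w : word) d : uniq w -> d < size w ->
  {in take d w ++ drop d.+1 w &, {mono lower (nth 0 w d) : x y / x < y}}.
Proof.
move=> uw ltd x y Hx Hy; have Hn := mem_take_drop uw ltd.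
by apply: lower_mono; rewrite inE; apply: contraNneq Hn => <-.
Qed.

Lemma size_del w d : d < size w -> size (del w d) = (size w).-1.
Proof.
move=> ltd; rewrite size_map size_cat size_drop size_take ltd; lia.
Qed.

Lemma del_perms_of n (w : word) d : w \in perms_of n.+1 -> d <= n ->
  del w d \in perms_of n.
Proof.
move=> Hw led; have Es := perms_of_size Hw; have uw := perms_of_uniq Hw.
have ltd : d < size w by rewrite Es.
have Hn := mem_take_drop uw ltd.
apply: perms_of_intro; first by rewrite size_del // Es.
  rewrite map_inj_in_uniq.
    by move: uw; rewrite {1}(take_drop_nth ltd) uniq_catC /= => /andP[_]; rewrite uniq_catC.
  move=> x y Hx Hy E.
  have := lower_mono_del uw ltd Hx Hy; have := lower_mono_del uw ltd Hy Hx.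
  rewrite E; lia.
move=> _ /mapP[x Hx ->].
have xw : x \in w.
  by rewrite (take_drop_nth ltd) mem_cat inE orbCA -mem_cat Hx orbT.
have vw := mem_nth 0 ltd.
have : x != nth 0 w d by apply: contraNneq Hn => <-.
by move: xw vw; rewrite !(perms_of_mem _ Hw); apply: lower_range.
Qed.

Lemma mask_del (m : bitseq) (w : word) d : size m = size w -> d < size w ->
  nth false m d = false ->
  mask (take d m ++ drop d.+1 m) (take d w ++ drop d.+1 w) = mask m w.
Proof.
move=> Em ltd Hd; have ltdm : d < size m by rewrite Em.
have Est : size (take d m) = size (take d w) by rewrite !size_take Em.
rewrite mask_cat // [in RHS](take_drop_nth ltd) -[in RHS](cat_take_drop d m).
by rewrite (drop_nth false ltdm) Hd mask_cat.
Qed.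

Lemma has_hit_del (pi w : word) d : uniq w -> d < size w ->
  has_hit pi (del w d) =
  [exists m : (size w).-tuple bool,
     ~~ nth false m d && order_iso (mask m w) pi].
Proof.
move=> uw ltd; apply/has_hitP/existsP.
  case=> m; rewrite size_del // => Em.
  rewrite -map_mask order_iso_map; last first.
    by move=> x y /mem_mask Hx /mem_mask Hy; apply: (lower_mono_del uw ltd).
  move=> Hm; pose m' := take d m ++ false :: drop d m.
  have ltdm : d <= size m by rewrite Em; lia.
  have Est : size (take d m) = d by rewrite size_takel.
  have Em' : size m' = size w by rewrite size_cat /= Est size_drop; lia.
  exists (tcast Em' (in_tuple m')); rewrite val_tcast /=.
  have Hd : nth false m' d = false by rewrite nth_cat Est ltnn subnn.
  rewrite Hd /= -(mask_del Em' ltd Hd).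
  rewrite take_cat Est ltnn subnn cats0 /m' drop_cat Est ltnNge leqnSn /= subSnn /=.
  by rewrite drop0 cat_take_drop.
case=> m /andP[/negbTE Hd Hm].
exists (take d m ++ drop d.+1 m).
  by rewrite size_del // size_cat size_take size_drop size_tuple ltd; lia.
rewrite -map_mask mask_del ?size_tuple // order_iso_map //.
rewrite -(mask_del _ ltd Hd) ?size_tuple //.
by move=> x y /mem_mask Hx /mem_mask Hy; apply: (lower_mono_del uw ltd).
Qed.

Lemma avoids_del (Pi : {fset word}) (w : word) d : uniq w -> d < size w ->
  avoids Pi w -> avoids Pi (del w d).
Proof.
move=> uw ltd /avoidsP H; apply/avoidsP => pi Hpi; apply: contra (H _ Hpi).
rewrite has_hit_del // => /existsP[m /andP[_ Hm]].
by apply/existsP; exists m.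
Qed.

Lemma size_le_max_length (Pi : {fset word}) (pi : word) :
  pi \in Pi -> size pi <= max_length Pi.
Proof. by move=> Hpi; apply: (@leq_bigmax_seq _ _ predT size). Qed.

Lemma avoids_check (Pi : {fset word}) l (w : word) :
  (forall pi : word, pi \in Pi -> is_pattern pi) -> w \in perms_of l.+1 ->
  avoids Pi w = (w \notin Pi) &&
    all (fun d => avoids Pi (del w d)) (iota 0 (minn (max_length Pi).+1 l.+1)).
Proof.
move=> HPi Hw; have Es := perms_of_size Hw; have uw := perms_of_uniq Hw.
apply/idP/andP => [Hav|[wPi /allP Hdel]].
  split; last first.
    apply/allP => d; rewrite mem_iota => ltd.
    by apply: avoids_del => //; lia.
  apply/negP => wPi; have /avoidsP/(_ _ wPi) := Hav; case/negP.
  apply/has_hitP; exists (nseq (size w) true); first by rewrite size_nseq.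
  by rewrite mask_true ?order_iso_refl.
apply/avoidsP => pi Hpi; apply/negP => /has_hitP[m Em Hm].
have /order_isoP[Esz _] := Hm.
have Ec : count id m = size pi by rewrite -Esz size_mask.
have lek := size_le_max_length Hpi.
have lepi : size pi <= l.+1 by rewrite -Ec -Es -Em count_size.
have ltpi : size pi < l.+1.
  rewrite ltn_neqAle lepi andbT; apply/negP => /eqP E.
  have [q _ Hq] := HPi _ Hpi.
  have E' := perms_of_size Hq; rewrite E in E'; rewrite -E' in Hq.
  have Em1 : all id m by rewrite all_count Ec E Em Es.
  have Emt : m = nseq (size w) true.
    by rewrite -Em; apply/all_pred1P; apply: sub_all Em1 => -[].
  move: Hm; rewrite Emt mask_true // => Hm.
  by move: wPi; rewrite (order_iso_perms Hw Hq Hm) Hpi.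
set q := minn _ _ in Hdel.
have ltq : size pi < q by rewrite /q; lia.
have leqm : q <= size m by rewrite Em Es /q; lia.
have : ~~ all id (take q m).
  rewrite all_count size_takel // neq_ltn.
  have : count id (take q m) <= count id m.
    by rewrite -{2}(cat_take_drop q m) count_cat leq_addr.
  by rewrite Ec; lia.
rewrite -has_predC => /(has_nthP false)[d]; rewrite size_takel // => ltdq.
rewrite nth_take //= => Hd.
have ltdw : d < size w by lia.
have : avoids Pi (del w d) by apply: Hdel; rewrite mem_iota.
move=> /avoidsP/(_ _ Hpi)/negP; apply; rewrite has_hit_del //.
have Em' : size m == size w by apply/eqP.
by apply/existsP; exists (Tuple Em'); rewrite /= Hd Hm.
Qed.

Lemma size_ins w p : size (ins w p) = (size w).+1.
Proof. by rewrite size_cat /= addnS -size_cat cat_take_drop. Qed.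

Lemma ins_perms_of n (w : word) p : w \in perms_of n -> ins w p \in perms_of n.+1.
Proof.
move=> Hw; rewrite mem_perms_of.
rewrite iota1S perm_sym perm_catC /= perm_sym.
rewrite /ins perm_catC /= (perms_of_size Hw) perm_cons.
by rewrite perm_catC cat_take_drop -mem_perms_of.
Qed.

Lemma index_ins n (w : word) p : w \in perms_of n -> p <= n ->
  index n.+1 (ins w p) = p.
Proof.
move=> Hw lep; have Es := perms_of_size Hw.
rewrite /ins index_cat Es /= eqxx addn0 size_takel ?Es //.
case: ifP => // /mem_take; rewrite (perms_of_mem _ Hw); lia.
Qed.

Lemma del_ins n (w : word) p : w \in perms_of n -> p <= n -> del (ins w p) p = w.
Proof.
move=> Hw lep; have Es := perms_of_size Hw.
have Et : size (take p w) = p by rewrite size_takel ?Es.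
rewrite /del /ins nth_cat take_cat drop_cat Et ltnn subnn /= cats0.
rewrite ltnNge leqnSn /= subSnn /= drop0 cat_take_drop -[RHS]map_id.
apply/eq_in_map => x; rewrite (perms_of_mem _ Hw) Es => /andP[_ lexn].
by rewrite lower_id // leqW.
Qed.

Lemma ins_del n (w : word) : w \in perms_of n.+1 ->
  exists2 p, p <= n & ins (del w p) p = w.
Proof.
move=> Hw; have Es := perms_of_size Hw; have uw := perms_of_uniq Hw.
have Hn : n.+1 \in w by rewrite (perms_of_mem _ Hw) /= leqnn.
pose p := index n.+1 w; have ltp : p < size w by rewrite index_mem.
have Ep : nth 0 w p = n.+1 by rewrite nth_index.
exists p; first by rewrite -ltnS -Es.
have Ed : del w p = take p w ++ drop p.+1 w.
  rewrite /del -[RHS]map_id; apply/eq_in_map => x Hx; rewrite Ep.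
  have : x \in w.
    by rewrite (take_drop_nth ltp) mem_cat inE orbCA -mem_cat Hx orbT.
  by rewrite (perms_of_mem _ Hw) => /andP[_ /lower_id].
rewrite /ins size_del // Es /= Ed.
have Et : size (take p w) = p by rewrite size_takel // ltnW.
rewrite take_cat drop_cat Et ltnn subnn /= take0 drop0 cats0 -Ep.
by rewrite -take_drop_nth.
Qed.

(** * Levels of avoiders *)

Definition children (l : nat) (ws : seq word) : seq word :=
  [seq ins w p | w <- ws, p <- iota 0 l.+1].

Fixpoint level (Pi : {fset word}) (l : nat) : seq word :=
  if l is l'.+1 then [seq c <- children l' (level Pi l') | avoids Pi c]
  else [:: [::]].

Lemma levelS Pi l :
  level Pi l.+1 = [seq c <- children l (level Pi l) | avoids Pi c].
Proof. by []. Qed.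

Arguments level : simpl never.

Lemma avoids_nil (Pi : {fset word}) :
  (forall pi : word, pi \in Pi -> is_pattern pi) -> avoids Pi [::].
Proof.
move=> HPi; apply/avoidsP => pi Hpi; apply/has_hitP => -[m _].
have [q q0 /perms_of_size Hq] := HPi _ Hpi.
by move=> /order_isoP[]; rewrite mask0 Hq /= => E; rewrite -E in q0.
Qed.

Section Levels.

Variable Pi : {fset word}.
Hypothesis HPi : forall pi : word, pi \in Pi -> is_pattern pi.

Lemma mem_level l (w : word) :
  (w \in level Pi l) = (w \in perms_of l) && avoids Pi w.
Proof.
elim: l w => [|l IH] w.
  rewrite [X in X && _]mem_perms_of mem_seq1; apply/eqP/andP => [->|[/perm_nilP ->] //].
  by split; rewrite ?avoids_nil.
rewrite levelS mem_filter andbC; apply/andP/andP => -[Hw Hav]; split=> //.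
  case/allpairsP: Hw => u [Hu _ ->].
  by apply: ins_perms_of; move: Hu; rewrite IH => /andP[].
have [p lep <-] := ins_del Hw.
apply: (allpairs_f ins); last by rewrite mem_iota.
by rewrite IH del_perms_of // avoids_del ?(perms_of_uniq Hw) ?(perms_of_size Hw).
Qed.

Lemma level_perms_of l (w : word) : w \in level Pi l -> w \in perms_of l.
Proof. by rewrite mem_level => /andP[]. Qed.

Lemma uniq_level l : uniq (level Pi l).
Proof.
elim: l => // l IH; rewrite levelS.
apply/filter_uniq/allpairs_uniq => //; first exact: iota_uniq.
move=> x y /allpairsP[u [Hw Hp ->]] /allpairsP[v [Hv Hq ->]] /= E.
move: Hp Hq; rewrite !mem_iota add0n !ltnS => /andP[_ Hp] /andP[_ Hq].
have Hw' := level_perms_of Hw; have Hv' := level_perms_of Hv.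
have Epq : u.2 = v.2 by rewrite -(index_ins Hw' Hp) -(index_ins Hv' Hq) E.
by congr pair => //; rewrite -(del_ins Hw' Hp) -(del_ins Hv' Hq) E Epq.
Qed.

Definition levels (l : nat) : seq word :=
  flatten [seq level Pi m | m <- iota 1 l].

Lemma levelsS l : levels l.+1 = levels l ++ level Pi l.+1.
Proof.
by rewrite /levels iota1S map_cat flatten_cat /= cats0.
Qed.

Lemma mem_levels l (w : word) : w \in levels l ->
  [/\ 0 < size w, size w <= l & w \in level Pi (size w)].
Proof.
case/flattenP => s /mapP[m]; rewrite mem_iota => Hm -> Hw.
have -> := perms_of_size (level_perms_of Hw); split=> //; lia.
Qed.

Lemma uniq_levels l : uniq (levels l).
Proof.
elim: l => // l IH; rewrite levelsS cat_uniq IH uniq_level andbT /=.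
apply/hasPn => w Hw; apply/negP => /mem_levels.
by rewrite (perms_of_size (level_perms_of Hw)) => -[]; lia.
Qed.

Lemma avoiders_leE l : avoiders_le Pi l = [fset w in levels l].
Proof.
apply/fsetP => w; rewrite !inE; apply/andP/flattenP.
  case=> /flattenP[s /mapP[m Hm ->] Hw] Hav.
  exists (level Pi m); first exact: map_f.
  by rewrite mem_level Hav andbT.
case=> s /mapP[m Hm ->]; rewrite mem_level => /andP[Hw Hav]; split=> //.
by apply/flattenP; exists (perms_of m); first exact: map_f.
Qed.

Lemma card_avoiders_le l : #|` avoiders_le Pi l| = size (levels l).
Proof. by rewrite avoiders_leE card_fseq undup_id ?uniq_levels. Qed.

End Levels.

Local Notation memory := Defs.mem.
Local Notation Sub := Defs.Sub.

(** * Total correctness with a time bound *)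

Definition runs (c : cmd) (s : state) (T : nat) (Q : state -> Prop) : Prop :=
  exists t s', [/\ exec c s t s', t <= T & Q s'].

Lemma runs_weaken c s T T' (Q Q' : state -> Prop) :
  runs c s T Q -> T <= T' -> (forall s', Q s' -> Q' s') -> runs c s T' Q'.
Proof.
move=> [t [s' [H leT HQ]]] leTT' QQ'; exists t, s'; split=> //.
  exact: leq_trans leTT'.
exact: QQ'.
Qed.

Lemma runs_le c s T T' Q : runs c s T Q -> T <= T' -> runs c s T' Q.
Proof. by move=> H leT; apply: runs_weaken H leT _. Qed.

Lemma runs_skip s (Q : state -> Prop) : Q s -> runs Skip s 1 Q.
Proof. by exists 1, s; split=> //; constructor. Qed.

Lemma runs_assign s x e (Q : state -> Prop) :
  Q (set_reg s x (eval s e)) -> runs (Assign x e) s (ecost e).+1 Q.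
Proof. by do 2!eexists; split; [constructor|exact: leqnn|]. Qed.

Lemma runs_store s a e (Q : state -> Prop) :
  Q (set_mem s (eval s a) (eval s e)) ->
  runs (Store a e) s (ecost a + ecost e).+1 Q.
Proof. by do 2!eexists; split; [constructor|exact: leqnn|]. Qed.

Lemma runs_insert s h a l (Q : state -> Prop) :
  Q (insert_tab s h (read_word s (eval s a) (eval s l))) ->
  runs (Insert h a l) s (ecost a + ecost l + eval s l).+1 Q.
Proof. by do 2!eexists; split; [constructor|exact: leqnn|]. Qed.

Lemma runs_member s x h a l (Q : state -> Prop) :
  Q (set_reg s x (read_word s (eval s a) (eval s l) \in tab s h)) ->
  runs (Member x h a l) s (ecost a + ecost l + eval s l).+1 Q.
Proof. by do 2!eexists; split; [constructor|exact: leqnn|]. Qed.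

Lemma runs_seq c1 c2 s T1 T2 (Q : state -> Prop) :
  runs c1 s T1 (fun s' => runs c2 s' T2 Q) -> runs (Seq c1 c2) s (T1 + T2) Q.
Proof.
move=> [t1 [s1 [H1 le1 [t2 [s2 [H2 le2 HQ]]]]]].
exists (t1 + t2), s2; split=> //; first exact: ExecSeq H1 H2.
exact: leq_add.
Qed.

Lemma runs_if e c1 c2 s T (Q : state -> Prop) :
  (if eval s e != 0 then runs c1 s T Q else runs c2 s T Q) ->
  runs (If e c1 c2) s (ecost e + T).+1 Q.
Proof.
case: ifP => [He|/negbFE/eqP He] [t [s' [H leT HQ]]]; exists (ecost e + t).+1, s'.
  by split; [exact: ExecIfTrue|rewrite ltnS leq_add2l|].
by split; [exact: ExecIfFalse|rewrite ltnS leq_add2l|].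
Qed.

Lemma runs_while e c N (T : nat -> nat) (I : nat -> state -> Prop) s
    (Q : state -> Prop) :
  I 0 s ->
  (forall i s', i < N -> I i s' -> eval s' e != 0 /\ runs c s' (T i) (I i.+1)) ->
  (forall s', I N s' -> eval s' e = 0 /\ Q s') ->
  runs (While e c) s (\sum_(i < N) (ecost e + T i).+1 + (ecost e).+1) Q.
Proof.
move=> I0 Hstep Hend.
elim: N T I s I0 Hstep Hend => [|N IH] T I s I0 Hstep Hend.
  rewrite big_ord0; have [E HQ] := Hend _ I0.
  by do 2!eexists; split; [exact: ExecWhileFalse|exact: leqnn|].
have [E [t1 [s1 [H1 le1 HI1]]]] := Hstep 0 s isT I0.
have [] := IH (fun i => T i.+1) (fun i => I i.+1) s1 HI1 _ Hend.
  by move=> i s' lti; apply: Hstep.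
move=> t2 [s2 [H2 le2 HQ]].
exists (ecost e + t1 + t2).+1, s2; split=> //.
  exact: ExecWhileTrue H1 H2.
have -> : \sum_(i < N.+1) (ecost e + T i).+1 =
    (ecost e + T 0).+1 + \sum_(i < N) (ecost e + T i.+1).+1.
  exact: big_ord_recl.
by move: (\sum_(i < N) _) le2 => S le2; lia.
Qed.

Lemma runs_for e c N T (I : nat -> state -> Prop) s (Q : state -> Prop) :
  I 0 s ->
  (forall i s', i < N -> I i s' -> eval s' e != 0 /\ runs c s' T (I i.+1)) ->
  (forall s', I N s' -> eval s' e = 0 /\ Q s') ->
  runs (While e c) s (N * (ecost e + T).+1 + (ecost e).+1) Q.
Proof.
move=> I0 Hstep Hend.
by have := runs_while (T := fun => T) I0 Hstep Hend; rewrite sum_nat_const card_ord.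
Qed.

Definition same_regs (xs : seq nat) (s s' : state) : Prop :=
  forall x, x \notin xs -> reg s' x = reg s x.

Lemma same_regs_set (xs : seq nat) s s' x v :
  x \in xs -> same_regs xs s s' -> same_regs xs s (set_reg s' x v).
Proof.
move=> Hx H y Hy; rewrite /= /upd; case: eqP => [E|_]; last exact: H.
by rewrite E Hx in Hy.
Qed.

Lemma same_regs_trans (xs ys : seq nat) s1 s2 s3 :
  {subset ys <= xs} ->
  same_regs xs s1 s2 -> same_regs ys s2 s3 -> same_regs xs s1 s3.
Proof.
move=> sub H12 H23 x Hx; rewrite H23 ?H12 //.
by apply: contra Hx => /sub.
Qed.

Lemma eq_read_word s s' a l :
  (forall i, i < l -> memory s' (a + i) = memory s (a + i)) ->
  read_word s' a l = read_word s a l.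
Proof.
move=> H; apply: (@eq_from_nth _ 0); rewrite ?size_mkseq // => i lti.
by rewrite !nth_mkseq ?H.
Qed.

Lemma nth_read_word s a l i : i < l -> nth 0 (read_word s a l) i = memory s (a + i).
Proof. exact: nth_mkseq. Qed.

Lemma read_wordP s a (w : word) :
  (forall i, i < size w -> memory s (a + i) = nth 0 w i) ->
  read_word s a (size w) = w.
Proof.
move=> H; apply: (@eq_from_nth _ 0); rewrite ?size_mkseq // => i lti.
by rewrite nth_read_word ?H.
Qed.

Lemma nth_ins w p i : p <= size w -> i <= size w ->
  nth 0 (ins w p) i =
  if i == p then (size w).+1 else nth 0 w (i - (p < i)).
Proof.
move=> lep lei; rewrite nth_cat size_takel //.
case: (ltngtP i p) => [ltip|ltpi|->]; rewrite ?subnn ?subn0 //.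
  by rewrite nth_take.
rewrite subn1 -(subnSK ltpi) /= nth_drop; congr nth; lia.
Qed.

Lemma nth_del w d i : d < size w -> i < (size w).-1 ->
  nth 0 (del w d) i = lower (nth 0 w d) (nth 0 w (i + (d <= i))).
Proof.
move=> ltd lti; have Es : size (take d w) = d by rewrite size_takel // ltnW.
rewrite (nth_map 0); last by rewrite size_cat Es size_drop; lia.
congr lower; rewrite nth_cat Es ltnNge; case: leqP => lid /=.
  by rewrite nth_drop; congr nth; lia.
by rewrite nth_take // addn0.
Qed.

(** * The program *)

Declare Scope cmd_scope.
Local Open Scope cmd_scope.
Notation "c1 ;; c2" := (Seq c1 c2) (at level 90, right associativity) : cmd_scope.

(* Registers: 0 is n, 1 is k, 2 the current length l, 3 the address of the
   current parent, 4 the end of the parents, 5 the first free address, 6 the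
   insertion position, 8 the deleted position, 12 the deleted letter, 10 the
   verdict on the candidate; 7, 9 and 11 are temporary. Addresses below n are
   scratch space for deletions; the words of level l, l.+1, ... are stored
   contiguously from address n on. *)
Definition incr (x : nat) : cmd := Assign x (Add (Reg x) (Cst 1)).
Definition next_len : expr := Add (Reg 2) (Cst 1).

(* The cell of the inserted letter first receives a junk value. *)
Definition build_cmd : cmd :=
  Assign 7 (Cst 0) ;;
  While (Lt (Reg 7) next_len)
    (Store (Add (Reg 5) (Reg 7))
       (Fetch (Sub (Add (Reg 3) (Reg 7)) (Lt (Reg 6) (Reg 7)))) ;;
     incr 7) ;;
  Store (Add (Reg 5) (Reg 6)) next_len.

Lemma runs_build s w p :
  read_word s (reg s 3) (reg s 2) = w -> reg s 3 + reg s 2 <= reg s 5 ->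
  reg s 6 = p -> p <= reg s 2 ->
  runs build_cmd s (50 * (reg s 2).+1) (fun s' =>
    [/\ same_regs [:: 7] s s', tab s' = tab s,
        forall a, a < reg s 5 -> memory s' a = memory s a
      & read_word s' (reg s 5) (reg s 2).+1 = ins w p]).
Proof.
set l := reg s 2; set h := reg s 3; set t := reg s 5 => Ew leht Ep lep.
have Esw : size w = l by rewrite -Ew size_mkseq.
pose I i s' := [/\ same_regs [:: 7] s s' /\ reg s' 7 = i, tab s' = tab s,
  forall a, a < t -> memory s' a = memory s a
  & forall j, j < i -> j != p -> memory s' (t + j) = nth 0 w (j - (p < j))].
apply: runs_le.
- apply/runs_seq/runs_assign/runs_seq.
  apply: (@runs_for _ _ l.+1 _ I).
  + split=> //; split=> //; exact: same_regs_set.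
  + move=> i s' lti [[fr E7] Et Em Ej]; split.
      by rewrite /= E7 fr // -/l; lia.
    apply/runs_seq/runs_store/runs_assign; split=> //.
    * split; last by rewrite /= /upd /= E7 addn1.
      by apply: same_regs_set.
    * move=> a lta /=; rewrite /upd E7 fr // -/t ifN ?Em //; lia.
    * move=> j ltj nejp /=; rewrite /upd E7 !fr // -/t -/h Ep eqn_add2l.
      case: eqP => [Eji|neji]; last by apply: Ej => //; lia.
      rewrite -Eji Em; last by lia.
      rewrite -Ew nth_read_word; last by lia.
      by congr memory; lia.
  + move=> s' [[fr E7] Et Em Ej]; split; first by rewrite /= E7 fr // -/l; lia.
    apply: runs_store; rewrite /= !fr // -/t -/l Ep; split=> //.
    * by move=> a lta; rewrite /= /upd ifN ?Em //; lia.
    * rewrite -Esw -(size_ins w p); apply: read_wordP => i.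
      rewrite size_ins ltnS Esw => lei; rewrite nth_ins ?Esw // /= /upd eqn_add2l.
      by case: eqP => [_|/eqP neip]; rewrite ?addn1 // Ej //; lia.
- by rewrite /=; lia.
Qed.

Definition delete_cmd : cmd :=
  let letter :=
    Fetch (Add (Add (Reg 5) (Reg 9)) (Lt (Reg 8) (Add (Reg 9) (Cst 1)))) in
  Assign 12 (Fetch (Add (Reg 5) (Reg 8))) ;;
  Assign 9 (Cst 0) ;;
  While (Lt (Reg 9) (Reg 2))
    (Store (Reg 9) (Sub letter (Lt (Reg 12) letter)) ;; incr 9).

Lemma runs_delete s w d :
  read_word s (reg s 5) (reg s 2).+1 = w -> reg s 2 <= reg s 5 ->
  reg s 8 = d -> d <= reg s 2 ->
  runs delete_cmd s (50 * (reg s 2).+1) (fun s' =>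
    [/\ same_regs [:: 9; 12] s s', tab s' = tab s,
        forall a, reg s 2 <= a -> memory s' a = memory s a
      & read_word s' 0 (reg s 2) = del w d]).
Proof.
set l := reg s 2; set t := reg s 5 => Ew lelt Ed led.
have Esw : size w = l.+1 by rewrite -Ew size_mkseq.
have ltd : d < size w by rewrite Esw.
have Ewt i : i <= l -> memory s (t + i) = nth 0 w i.
  by move=> lei; rewrite -Ew nth_read_word.
pose I i s' := [/\ same_regs [:: 9; 12] s s',
  reg s' 9 = i /\ reg s' 12 = nth 0 w d, tab s' = tab s,
  forall a, l <= a -> memory s' a = memory s a
  & forall j, j < i -> memory s' j = nth 0 (del w d) j].
apply: runs_le.
- apply/runs_seq/runs_assign/runs_seq/runs_assign.
  apply: (@runs_for _ _ l _ I).
  + split=> //; last by rewrite /= /upd /= Ed -/t Ewt.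
    by do 2!apply: same_regs_set => //.
  + move=> i s' lti [fr [E9 E12] Et Em Ej]; split.
      by rewrite /= E9 fr // -/l; lia.
    apply/runs_seq/runs_store/runs_assign; split=> //.
    * by apply: same_regs_set.
    * by rewrite /= /upd /= E9 E12 addn1.
    * by move=> a lea /=; rewrite /upd E9 ifN ?Em //; lia.
    * move=> j ltj /=; rewrite /upd E9 E12 !fr // -/t Ed.
      case: eqP => [->|neji]; last by apply: Ej; lia.
      rewrite nth_del ?Esw // /lower Em; last by lia.
      by rewrite -addnA Ewt addn1 ltnS //; lia.
  + move=> s' [fr [E9 E12] Et Em Ej]; split; first by rewrite /= E9 fr // -/l; lia.
    split=> //; rewrite -[l]/(l.+1.-1) -Esw -(size_del ltd).
    by apply: read_wordP => i; rewrite size_del // Esw => lti; rewrite Ej.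
- by rewrite /=; lia.
Qed.

Definition check_cmd : cmd :=
  Member 11 0 (Reg 5) next_len ;;
  Assign 10 (Sub (Cst 1) (Reg 11)) ;;
  Assign 8 (Cst 0) ;;
  While (Lt (Cst 1) (Add (Lt (Reg 8) (Add (Reg 1) (Cst 1)))
                         (Lt (Reg 8) next_len)))
    (delete_cmd ;;
     Member 11 1 (Cst 0) (Reg 2) ;;
     Assign 10 (Lt (Cst 1) (Add (Reg 10) (Reg 11))) ;;
     incr 8).

Lemma runs_check s w :
  read_word s (reg s 5) (reg s 2).+1 = w -> reg s 2 <= reg s 5 ->
  runs check_cmd s (300 * ((reg s 1).+1 * (reg s 2).+1)) (fun s' =>
    [/\ same_regs [:: 8; 9; 10; 11; 12] s s', tab s' = tab s,
        forall a, reg s 2 <= a -> memory s' a = memory s a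
      & reg s' 10 = (w \notin tab s 0) &&
          all (fun d => del w d \in tab s 1)
            (iota 0 (minn (reg s 1).+1 (reg s 2).+1))]).
Proof.
set k := reg s 1; set l := reg s 2; set t := reg s 5 => Ew lelt.
pose I i s' := [/\ same_regs [:: 8; 9; 10; 11; 12] s s',
  reg s' 8 = i, tab s' = tab s,
  forall a, l <= a -> memory s' a = memory s a
  & reg s' 10 = (w \notin tab s 0) &&
          all (fun d => del w d \in tab s 1) (iota 0 i)].
apply: runs_le.
- apply/runs_seq/runs_member/runs_seq/runs_assign/runs_seq/runs_assign.
  apply: (@runs_for _ _ (minn k.+1 l.+1) _ I).
  + split=> //; first by do 3!apply: same_regs_set => //.
    by rewrite /= /upd /= andbT -/t -/l addn1 Ew; case: (_ \in _).
  + move=> i s' lti [fr E8 Et Em E10]; split.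
      by rewrite /= E8 !fr // -/l -/k; lia.
    apply/runs_seq; apply: runs_weaken.
    * apply: (@runs_delete s' w i) => //; rewrite ?fr // -/l -/t //; last by lia.
      by rewrite -Ew; apply: eq_read_word => j _; apply: Em; lia.
    * rewrite fr // -/l; exact: leqnn.
    * move=> s1 [fr1 Et1 Em1 Er].
      apply/runs_seq; apply: runs_le.
        apply: runs_member; apply/runs_seq/runs_assign/runs_assign; split.
        - do 3!apply: same_regs_set => //.
          by apply: same_regs_trans fr fr1 => x; rewrite !inE => /orP[] /eqP ->.
        - by rewrite /= /upd /= fr1 // E8 addn1.
        - by rewrite /= Et1 Et.
        - by move=> a lea; rewrite /= Em1 ?fr // Em.
        have -> P : all P (iota 0 i.+1) = all P (iota 0 i) && P i.
          by rewrite -(addn1 i) iotaD all_cat /= andbT.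
        rewrite /= /upd /= !fr1 // E10 Er Et1 Et andbA.
        by case: (_ && _); case: (_ \in _).
      by rewrite /= !fr1 // fr // -/l; exact: leqnn.
  + move=> s' [fr E8 Et Em E10]; split; last by [].
    by rewrite /= E8 !fr // -/l -/k; lia.
- have lem : minn k.+1 l.+1 * l.+1 <= k.+1 * l.+1 by rewrite leq_mul2r geq_minl orbT.
  have lek : minn k.+1 l.+1 <= k.+1 by exact: geq_minl.
  by rewrite /= -/l; move: (minn _ _) lem lek => m; nia.
Qed.

Fixpoint stored (s : state) (a : nat) (ws : seq word) : Prop :=
  if ws is w :: ws' then
    read_word s a (size w) = w /\ stored s (a + size w) ws'
  else True.

Lemma eq_stored s s' a ws :
  (forall b, a <= b < a + size (flatten ws) -> memory s' b = memory s b) ->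
  stored s a ws -> stored s' a ws.
Proof.
elim: ws a => //= w ws IH a Hm [Hw Hs]; rewrite size_cat in Hm; split.
  by rewrite -[RHS]Hw; apply: eq_read_word => i lti; apply: Hm; lia.
by apply: IH Hs => b Hb; apply: Hm; lia.
Qed.

Lemma stored_cat s a u v :
  stored s a u -> stored s (a + size (flatten u)) v -> stored s a (u ++ v).
Proof.
elim: u a => [|w u IH] a /=; first by rewrite addn0.
by move=> [Hw Hu]; rewrite size_cat addnA; split=> //; apply: IH.
Qed.

Definition step_cmd : cmd :=
  build_cmd ;; check_cmd ;;
  If (Reg 10)
    (Insert 1 (Reg 5) next_len ;; Assign 5 (Add (Reg 5) next_len)) Skip ;;
  incr 6.

Definition parent_cmd : cmd :=
  Assign 6 (Cst 0) ;;
  While (Lt (Reg 6) next_len) step_cmd ;;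
  Assign 3 (Add (Reg 3) (Reg 2)).

Definition level_cmd : cmd :=
  While (Lt (Reg 3) (Reg 4)) parent_cmd ;;
  incr 2 ;; Assign 4 (Reg 5).

Definition main_cmd : cmd :=
  Store (Reg 0) (Cst 1) ;;
  Member 11 0 (Reg 0) (Cst 1) ;;
  If (Reg 11) Skip
    (Insert 1 (Reg 0) (Cst 1) ;;
     Assign 2 (Cst 1) ;;
     Assign 3 (Reg 0) ;;
     Assign 4 (Add (Reg 0) (Cst 1)) ;;
     Assign 5 (Reg 4) ;;
     While (Lt (Reg 2) (Reg 0)) level_cmd).

(** * Correctness and cost *)

Section Correctness.

Variables (Pi : {fset word}) (n : nat).
Hypothesis HPi : forall pi : word, pi \in Pi -> is_pattern pi.

Let k := max_length Pi.

(* [ws] are the parents still to be treated, [new] the avoiders of length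
   l.+1 found so far. *)
Definition level_inv (l : nat) (ws : seq word) (e : nat) (new : seq word)
    (s : state) : Prop :=
  [/\ [/\ reg s 0 = n, reg s 1 = k, reg s 2 = l, reg s 4 = e
        & reg s 5 = e + size (flatten new)],
      n <= reg s 3 /\ reg s 3 + size (flatten ws) = e,
      tab s 0 = Pi /\ tab s 1 = [fset w in levels Pi l ++ new],
      stored s (reg s 3) ws & stored s e new].

Lemma mem_del_levels l (w : word) (new : seq word) d :
  0 < l -> w \in perms_of l.+1 -> d <= l ->
  {in new, forall c : word, size c = l.+1} ->
  (del w d \in levels Pi l ++ new) = avoids Pi (del w d).
Proof.
move=> l0 Hw led Hnew; have Hd := del_perms_of Hw led.
have Es := perms_of_size Hd.
rewrite mem_cat; apply/orP/idP => [[Hl|/Hnew]|Hav].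
- by have [_ _] := mem_levels HPi Hl; rewrite mem_level // => /andP[].
- by rewrite Es; lia.
left; apply/flattenP; exists (level Pi l); last by rewrite mem_level // Hd.
by apply: map_f; rewrite mem_iota; lia.
Qed.

Lemma runs_step l (w : word) (ws : seq word) e (new : seq word) p s :
  0 < l < n -> w \in perms_of l -> p <= l ->
  {in new, forall c : word, size c = l.+1} ->
  level_inv l (w :: ws) e new s -> reg s 6 = p ->
  runs step_cmd s (400 * (k.+1 * l.+1)) (fun s' =>
    level_inv l (w :: ws) e (new ++ [seq c <- [:: ins w p] | avoids Pi c]) s'
    /\ reg s' 6 = p.+1).
Proof.
move=> /andP[l0 ltn] Hw lep Hnew; have Esw := perms_of_size Hw.
move=> [[E0 E1 E2 E4 E5] [le3 E3] [Et0 Et1] Hws Hsn] E6.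
have Hi := ins_perms_of p Hw.
have Hleh : reg s 3 + l <= e by move: E3; rewrite /= size_cat Esw; lia.
apply: runs_le.
- apply: runs_seq; apply: runs_weaken.
  + apply: (@runs_build s w p) => //; rewrite E2 ?E5 //; last by lia.
    by rewrite -Esw; case: Hws.
  + rewrite E2; exact: leqnn.
  move=> s1 [fr1 t1 m1 r1].
  apply: runs_seq; apply: runs_weaken.
  + apply: (@runs_check s1 (ins w p)); rewrite !fr1 //.
    by rewrite E2 E5; lia.
  + rewrite !fr1 // E1 E2; exact: leqnn.
  move=> s2 [fr2 t2 m2 r2].
  have fr (x : nat) : x \notin [:: 7; 8; 9; 10; 11; 12] -> reg s2 x = reg s x.
    rewrite inE negb_or => /andP[Hx Hx'].
    by rewrite fr2 ?fr1 // inE.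
  have Et : tab s2 = tab s by rewrite t2 t1.
  have Em a : l <= a < reg s 5 -> memory s2 a = memory s a.
    by case/andP=> lea lta; rewrite m2 ?m1 // fr1 // E2.
  have Er : read_word s2 (reg s 5) l.+1 = ins w p.
    rewrite -r1 E2; apply: eq_read_word => i lti; apply: m2.
    by rewrite fr1 // E2 E5; lia.
  have Hok : reg s2 10 = avoids Pi (ins w p).
    rewrite r2 !fr1 // t1 E1 E2 Et0 Et1 (avoids_check HPi Hi); congr (nat_of_bool (_ && _)).
    apply/eq_in_all => d; rewrite mem_iota !inE -mem_cat => Hd.
    by apply: mem_del_levels => //; lia.
  have Hws2 : stored s2 (reg s 3) (w :: ws).
    by apply: eq_stored Hws => b Hb; apply: Em; lia.
  have Hsn2 : stored s2 e new.
    by apply: eq_stored Hsn => b Hb; apply: Em; lia.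
  apply: runs_seq; apply: runs_if; rewrite [eval _ _]Hok /=.
  case: (boolP (avoids Pi (ins w p))) => Hav /=.
  + apply: runs_seq; apply: runs_le.
      apply: runs_insert; apply: runs_assign; apply: runs_assign.
      split; last by rewrite /= /upd /= fr // E6 addn1.
      split=> //=; rewrite /upd /= ?fr //.
      * split=> //; rewrite ?fr // flatten_cat size_cat /= cats0 size_ins.
        by rewrite E5 E2 Esw; lia.
      * rewrite Et Et0; split=> //.
        rewrite Et1 E2 addn1 Er; apply/fsetP => x; rewrite !inE.
        by case: (x == _); rewrite ?orbT ?orbF.
      * exact: (eq_stored _ Hws2).
      * apply: (@eq_stored s2) => //; apply: stored_cat => //; split=> //.
        by rewrite size_ins Esw -E5.
    rewrite /= fr // E2; exact: leqnn.
  + apply: runs_le.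
      apply: runs_skip; apply: runs_assign.
      split; last by rewrite /= /upd /= fr // E6 addn1.
      rewrite cats0.
      split=> //=; rewrite /upd /= ?fr // ?Et //.
      * exact: (eq_stored _ Hws2).
      * exact: (eq_stored _ Hsn2).
    by [].
- rewrite /=; nia.
Qed.

Lemma runs_parent l (w : word) (ws : seq word) e (new : seq word) s :
  0 < l < n -> w \in perms_of l ->
  {in new, forall c : word, size c = l.+1} ->
  level_inv l (w :: ws) e new s ->
  runs parent_cmd s (500 * (k.+1 * (l.+1 * l.+1)))
    (level_inv l ws e (new ++ [seq c <- children l [:: w] | avoids Pi c])).
Proof.
move=> Hl Hw Hnew HI; have Esw := perms_of_size Hw.
pose out i := new ++ [seq c <- [seq ins w p | p <- iota 0 i] | avoids Pi c].
pose I i s' := level_inv l (w :: ws) e (out i) s' /\ reg s' 6 = i.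
have -> : children l [:: w] = [seq ins w p | p <- iota 0 l.+1].
  by rewrite /children /= cats0.
rewrite -/(out l.+1).
apply: runs_le.
- apply: runs_seq; apply: runs_assign; apply: runs_seq.
  apply: (@runs_for _ _ l.+1 _ I).
  + split=> //; rewrite /out cats0; case: HI => [[? ? ? ? ?] ? ? Hws Hn].
    by split=> //; [exact: (eq_stored _ Hws)|exact: (eq_stored _ Hn)].
  + move=> i s' lti [HI' E6]; split.
      by case: HI' => [[_ _ E2 _ _] _ _ _ _]; rewrite /= E6 E2; lia.
    have Eout : out i.+1 = out i ++ [seq c <- [:: ins w i] | avoids Pi c].
      by rewrite /out -(addn1 i) iotaD map_cat filter_cat catA.
    rewrite /I Eout; apply: runs_step => // c; rewrite mem_cat mem_filter => /orP[/Hnew //|].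
    by case/andP=> _ /mapP[p _ ->]; rewrite size_ins Esw.
  + move=> s' [HI' E6]; case: (HI') => [[E0 E1 E2 E4 E5] [le3 E3] Et [_ Hws] Hn].
    split; first by rewrite /= E6 E2; lia.
    apply: runs_assign; split=> //=; rewrite /upd /= ?E2 //.
    * by move: E3; rewrite /= size_cat Esw; split; lia.
    * by apply: (@eq_stored s') => //; rewrite -{1}Esw.
    * exact: (eq_stored _ Hn).
- rewrite /=; nia.
Qed.

Lemma runs_level l s :
  0 < l < n ->
  (exists e, level_inv l (level Pi l) e [::] s) ->
  runs level_cmd s (size (level Pi l) * (510 * (k.+1 * (n * n))) + 20)
    (fun s' => exists e, level_inv l.+1 (level Pi l.+1) e [::] s').
Proof.
move=> Hl [e HI]; set L := level Pi l.
pose out i := [seq c <- children l (take i L) | avoids Pi c].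
pose I i := level_inv l (drop i L) e (out i).
have szL (w : word) : w \in L -> size w = l by move/(level_perms_of HPi)/perms_of_size.
apply: runs_le.
- apply: runs_seq.
  apply: (@runs_for _ _ (size L) _ I).
  + by rewrite /I /out take0 drop0.
  + move=> i s' lti HI'.
    have Hw : nth [::] L i \in L by apply: mem_nth.
    move: HI'; rewrite /I (drop_nth [::] lti) => HI'; split.
      case: (HI') => [[_ _ _ E4 _] [_ E3] _ _ _].
      by move: E3; rewrite /= E4 size_cat szL // => E3; lia.
    have Eout : out i.+1 =
        out i ++ [seq c <- children l [:: nth [::] L i] | avoids Pi c].
      rewrite /out (take_nth [::] lti) -cats1 /children -filter_cat.
      by rewrite map_cat flatten_cat.
    rewrite Eout; apply: runs_parent => //; first exact: level_perms_of Hw.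
    move=> c; rewrite mem_filter => /andP[_ /allpairsP[u [Hu _ ->]]].
    by rewrite size_ins szL // (mem_take Hu).
  + move=> s'; rewrite /I drop_size /out take_size -levelS.
    move=> [[E0 E1 E2 E4 E5] [le3 E3] [Et0 Et1] _ Hn].
    rewrite /= addn0 in E3; split; first by rewrite /= E3 E4; lia.
    apply: runs_seq; apply: runs_assign; apply: runs_assign.
    exists (reg s' 5); split=> //=; rewrite /upd /=.
    * by rewrite E2 addn1 addn0; split.
    * by split=> //; rewrite E5 E3.
    * by rewrite cats0 levelsS.
    * rewrite E3; exact: (eq_stored _ Hn).
- have le_ln : l.+1 * l.+1 <= n * n by apply: leq_mul; lia.
  have le_cost : 500 * (k.+1 * (l.+1 * l.+1)) + 4 <= 510 * (k.+1 * (n * n)).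
    by move: (n * n) le_ln => q le_q; nia.
  have := leq_mul (leqnn (size L)) le_cost.
  by rewrite /=; move: (510 * _) (k.+1 * _) => X Y; nia.
Qed.

Lemma avoids_one : avoids Pi [:: 1] = ([:: 1] \notin Pi).
Proof.
have H1 : [:: 1] \in perms_of 1 by rewrite mem_perms_of.
rewrite (avoids_check HPi H1); apply/andb_idr => _; apply/allP => d.
by rewrite mem_iota ltnNge geq_min orbC; case: d => // _; apply: avoids_nil.
Qed.

Lemma level1 : level Pi 1 = if [:: 1] \in Pi then [::] else [:: [:: 1]].
Proof.
rewrite levelS (_ : children 0 _ = [:: [:: 1]]) // [LHS]/= avoids_one.
by case: ([:: 1] \in Pi).
Qed.

Lemma levels_nil l : [:: 1] \in Pi -> levels Pi l = [::].
Proof.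
move=> H1; suff Hl m : level Pi m.+1 = [::].
  by elim: l => // l IH; rewrite levelsS IH Hl.
elim: m => [|m IH]; first by rewrite level1 H1.
by rewrite levelS IH.
Qed.

Lemma sum_level_cost X m :
  \sum_(i < m) (3 + (size (level Pi i.+1) * X + 20)).+1 =
  size (levels Pi m) * X + 24 * m.
Proof.
elim: m => [|m IH]; first by rewrite big_ord0.
by rewrite big_ord_recr /= IH levelsS size_cat mulnDl; lia.
Qed.

Lemma runs_main : 0 < k -> 0 < n ->
  runs main_cmd (input_state Pi n)
    (1200 * maxn 1 (size (levels Pi n.-1) * n ^ 2 * k))
    (fun s => output s = [fset w in levels Pi n]).
Proof.
move=> k0 n0; have [H1|H1] := boolP ([:: 1] \in Pi).
  apply: (@runs_le _ _ 100); last by lia.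
  apply: runs_le.
    apply/runs_seq/runs_store/runs_seq/runs_member/runs_if => /=.
    rewrite /read_word /mkseq /= addn0 /upd !eqxx H1 /=; apply: runs_skip.
    by rewrite levels_nil //; apply/fsetP => x; rewrite !inE.
  by [].
pose I i s := exists e, level_inv i.+1 (level Pi i.+1) e [::] s.
apply: runs_le.
  apply/runs_seq/runs_store/runs_seq/runs_member/runs_if => /=.
  rewrite /read_word /mkseq /= addn0 /upd !eqxx (negbTE H1) /=.
  apply/runs_seq/runs_insert/runs_seq/runs_assign/runs_seq/runs_assign.
  apply/runs_seq/runs_assign/runs_seq/runs_assign.
  apply: (@runs_while _ _ n.-1 (fun i =>
    size (level Pi i.+1) * (510 * (k.+1 * (n * n))) + 20) I).
  - exists n.+1; rewrite level1 (negbTE H1); split=> //=.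
    + by rewrite /upd /= addn0 addn1; split.
    + by rewrite /upd /= addn1.
    + split=> //; rewrite /upd /=; apply/fsetP => x.
      rewrite /levels /= level1 (negbTE H1) /= !inE /read_word /mkseq /= addn0.
      by rewrite /upd eqxx orbF.
    + by split=> //; rewrite /read_word /mkseq /= addn0 /upd /= eqxx.
  - move=> i s lti HI; split; last by apply: runs_level => //; lia.
    by case: HI => e [[E0 _ E2 _ _] _ _ _ _]; rewrite /= E0 E2; lia.
  - move=> s [e [[E0 _ E2 _ _] _ [_ Et] _ _]]; rewrite prednK // in E2 Et *.
    by rewrite /= E0 E2 ltnn; split=> //; rewrite /output Et cats0.
rewrite /= sum_level_cost.
have lev0 : 1 < n -> 0 < size (levels Pi n.-1).
  by case: n => [|[|m]] // _; rewrite /levels /= level1 (negbTE H1).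
have -> : n ^ 2 = n * n by rewrite expnS expn1.
move: (size _) lev0 => S lev0.
have Hk : S * (510 * (k.+1 * (n * n))) <= 1020 * (S * (n * n) * k).
  move: (n * n) => q; nia.
have Hn : 24 * n.-1 <= 24 * (S * (n * n) * k).
  case: (ltnP 1 n) lev0 => [lt1n /(_ isT) S0|len1 _]; last by lia.
  suff : n <= S * (n * n) * k by lia.
  by apply: leq_trans (_ : n * n <= _); nia.
by move: (S * _) (S * _ * _) Hk Hn => X Y; lia.
Qed.

End Correctness.

Lemma max_length_gt0 (Pi : {fset word}) : Pi <> fset0 ->
  (forall pi : word, pi \in Pi -> is_pattern pi) -> 0 < max_length Pi.
Proof.
move=> /eqP/fset0Pn[pi Hpi] HPi; have [m m0 /perms_of_size E] := HPi _ Hpi.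
by apply: leq_trans (size_le_max_length Hpi); rewrite E.
Qed.

(* "O(f)" has one constant for all inputs; as f vanishes when n = 1 or when Pi
   contains the one-letter pattern, it is read as "at most C * max(1, f)". *)
Theorem theorem3p3 :
  exists (p : cmd) (C : nat),
    forall (Pi : {fset word}) (n : nat),
      Pi <> fset0 ->
      (forall pi : word, pi \in Pi -> is_pattern pi) ->
      0 < n ->
      constructs p Pi n (avoiders_le Pi n)
        (C * maxn 1 (#|` avoiders_le Pi n.-1| * n ^ 2 * max_length Pi)).
Proof.
exists main_cmd, 1200 => Pi n nePi HPi n0.
have [t [s [H leT Hout]]] := runs_main HPi (max_length_gt0 nePi HPi) n0.
by exists t, s; rewrite card_avoiders_le // avoiders_leE.
Qed.
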